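(* Let $k$ be a fixed positive integer (not depending on $n$). For the binomial random intersection graph $G_b(n,P_n,p_n)$, define $\alpha_n$ by $$p_n^2P_n=\frac{\ln n+(k-1)\ln\ln n+\alpha_n}{n}.$$ If $P_n=\Omega\big(n(\ln n)^5\big)$ and $|\alpha_n|=o(\ln n)$, then $$\lim_{n\to\infty}\mathbb{P}[G_b(n,P_n,p_n)\text{ is }k\text{-robust}]=\begin{cases}0,&\text{if }\lim_{n\to\infty}\alpha_n=-\infty,\\ 1,&\text{if }\lim_{n\to\infty}\alpha_n=\infty.\end{cases}$$
   Context: Binomial random intersection graph $G_b(n,P_n,p_n)$: $n$ nodes $v_1,\ldots,v_n$ and a pool of $P_n$ distinct objects; each node $v_i$ gets an object set $S_i$ obtained by including each object independently with probability $p_n$, independently over nodes; distinct $v_i,v_j$ are adjacent iff $S_i\cap S_j\neq\emptyset$. A graph with node set $\mathcal{V}$ is $k$-robust if for every nonempty proper subset $T\subsetneq\mathcal{V}$, either some node in $T$ has at least $k$ neighbors in $\mathcal{V}\setminus T$, or some node in $\mathcal{V}\setminus T$ has at least $k$ neighbors in $T$. All limits and asymptotic notation are as $n\to\infty$. *)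

(* Defs.v *)
From mathcomp Require Import all_boot all_order all_algebra.
From mathcomp Require Import all_classical all_reals all_analysis.
Set Implicit Arguments.
Unset Strict Implicit.
Unset Printing Implicit Defensive.
Import Order.TTheory GRing.Theory Num.Theory.
Import numFieldNormedType.Exports.
Local Open Scope ring_scope.

Definition k_robust (V : finType) (adj : rel V) (k : nat) : bool :=
  [forall T : {set V}, (T != finset.set0) && (T != finset.setT) ==>
     [exists x in T, (k <= #|[set y in ~: T | adj x y]|)%N] ||
     [exists x in ~: T, (k <= #|[set y in T | adj x y]|)%N]]%SET.

(* [S i] is the object set of node [i]. *)
Definition intersection_adj (n P : nat)
    (S : {ffun 'I_n -> {set 'I_P}}) : rel 'I_n :=
  fun i j => (i != j) && (S i :&: S j != finset.set0)%SET.

(* The joint law of the object sets: the n * P inclusion events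
   "object o is in S i" are independent, each of probability p. *)
Definition object_sets_pmf (R : realType) (n P : nat) (p : R)
    (S : {ffun 'I_n -> {set 'I_P}}) : R :=
  \prod_(i < n) \prod_(o < P) (if o \in S i then p else 1 - p).

Definition Gb_prob (R : realType) (n P : nat) (p : R) (E : rel 'I_n -> bool) : R :=
  \sum_(S : {ffun 'I_n -> {set 'I_P}} | E (intersection_adj S))
     object_sets_pmf p S.

Lemma object_sets_pmf_ge0 (R : realType) (n P : nat) (p : R)
    (S : {ffun 'I_n -> {set 'I_P}}) : 0 <= p <= 1 -> 0 <= object_sets_pmf p S.
Proof.
move=> /andP[p0 p1]; apply: prodr_ge0 => i _; apply: prodr_ge0 => o _.
by case: ifP => // _; rewrite subr_ge0.
Qed.

Lemma Gb_prob_total (R : realType) (n P : nat) (p : R) :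
  Gb_prob P p (fun _ : rel 'I_n => true) = 1.
Proof.
rewrite /Gb_prob /object_sets_pmf.
rewrite -(bigA_distr_bigA (fun (_ : 'I_n) (A : {set 'I_P}) =>
  \prod_(o < P) (if o \in A then p else 1 - p))).
rewrite big1// => _ _.
have := @bigA_distr R 0 1 *%R +%R _ (fun _ : 'I_P => p) (fun _ => 1 - p).
rewrite big1 => [|o _]; last exact: (subrKC p 1).
by move=> e; rewrite [RHS]e; apply: eq_bigl.
Qed.

(* Main.v *)
Require Import Defs.
From mathcomp Require Import all_boot all_order all_algebra.
From mathcomp Require Import all_classical all_reals all_analysis.
From mathcomp Require Import ring lra zify.
(* Restores the names that [classical_sets] shadows. *)
From mathcomp.boot Require Import fintype finset.
Set Implicit Arguments.
Unset Strict Implicit.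
Unset Printing Implicit Defensive.
Import Order.TTheory GRing.Theory Num.Theory.
Import numFieldNormedType.Exports.
Local Open Scope ring_scope.

(** Dually to the object sets, every object [o] has a set [holders S o] of nodes,
    and these holder sets are i.i.d. over the objects, each node belonging to a
    given one with probability [p].  Since [n p ln n] stays bounded, objects with
    three or more holders are negligible, and an object with holders [{i, j}]
    just adds the edge [ij]; its probability is [beta = p^2 (1 - p)^(n - 2)].
    Write [d = n p^2 P], [l = k - 1] and [s = n (ln n)^l exp (- d) = exp (- alpha)].

    If [s] tends to 0: for [|T| = t <= n / 2], let [Z] be the number of pairs in
    [T * ~: T] that are the holder set of some object.  If every node of [T] has
    at most [l] neighbours outside [T] then [Z <= l t], so by Markov with
    [x = 1 / ln n] this has probability at most [x^(- l t) E[x^Z]].  The pairs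
    compete for the objects, so [x^Z] has at most the mean it would have for
    independent pairs, namely [(x + (1 - x) (1 - beta)^P)^(t (n - t))].
    The union bound over [T] is then at most [2 exp(5) s].

    If [s] tends to infinity: count the nodes [i] belonging to exactly [l] holder
    sets of size 2 and to none of size at least 3.  They have degree at most [l],
    which contradicts [k]-robustness on [T = {i}].  Their expected number is at
    least a constant times [s], and by the second moment method there is such a
    node with probability tending to 1. *)

(** * Subsets and binomial coefficients *)

Section SubsetSums.
Variables (R : comNzRingType) (T : finType).
Implicit Types A B : {set T}.

Lemma prodr_if_mem A (u v : R) :
  \prod_x (if x \in A then u else v) = u ^+ #|A| * v ^+ (#|T| - #|A|).
Proof.
rewrite (bigID (mem A))/=; congr (_ * _).
  by under eq_bigr => x -> do []; rewrite prodr_const.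
under eq_bigr => x /negbTE -> do [].
by rewrite prodr_const -(cardC A) addKn.
Qed.

Lemma prodrD_subset A (f g : T -> R) :
  \prod_(x in A) (f x + g x) =
  \sum_(B : {set T} | B \subset A) (\prod_(x in B) f x) * \prod_(x in A :\: B) g x.
Proof.
transitivity (\prod_x ((if x \in A then f x else 0) + (if x \in A then g x else 1))).
  by rewrite big_mkcond; apply: eq_bigr => x _; case: ifP; rewrite ?add0r.
rewrite (@bigA_distr R 0 1 *%R +%R)/= [RHS]big_mkcond/=; apply: eq_bigr => B _.
case: ifPn => [/subsetP BA|/subsetPn[x xB xA]]; last first.
  by rewrite (bigD1 x)//= xB (negbTE xA) mul0r.
rewrite (bigID (mem B))/=; congr (_ * _).
  by apply: eq_bigr => x xB; rewrite xB BA.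
under eq_bigr => x /negbTE -> do [].
by rewrite -big_mkcondr; apply: eq_bigl => x; rewrite !inE.
Qed.

Lemma sumr_exp_card_subset A (u : R) :
  \sum_(B : {set T} | B \subset A) u ^+ #|B| = (1 + u) ^+ #|A|.
Proof.
rewrite addrC -prodr_const prodrD_subset; apply: eq_bigr => B _.
by rewrite prodr_const big1// mulr1.
Qed.

Lemma sumr_by_card (q : pred nat) (g : nat -> R) :
  \sum_(A : {set T} | q #|A|) g #|A| = \sum_(t < #|T|.+1 | q t) 'C(#|T|, t)%:R * g t.
Proof.
have cardT A : (#|A| < #|T|.+1)%N by rewrite ltnS max_card.
rewrite (partition_big (fun A => Ordinal (cardT A)) (fun t => q t))//=.
apply: eq_bigr => t qt; rewrite -card_draws mulr_natl -sumr_const.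
apply: eq_big => [A|A /andP[_ /eqP <-]//]; rewrite inE -val_eqE/=.
by case: eqP => [->|_]; rewrite ?qt ?andbF.
Qed.

Lemma sumr_card_const (l : nat) (u : R) :
  \sum_(A : {set T} | #|A| == l) u = 'C(#|T|, l)%:R * u.
Proof. by rewrite -card_draws mulr_natl -sumr_const; apply: eq_bigl => A; rewrite inE. Qed.

End SubsetSums.

Lemma ffact_le_expn (n t : nat) : (n ^_ t <= n ^ t)%N.
Proof.
elim: t n => [|t IH] [|n]; rewrite ?ffactn0 ?ffact0n //.
rewrite ffactSS expnS leq_mul2l/=; apply: leq_trans (IH n) _.
by case: t {IH} => // t; rewrite leq_exp2r.
Qed.

Lemma expn_subn_le_ffact (n t : nat) : ((n - t) ^ t <= n ^_ t)%N.
Proof.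
elim: t n => [|t IH] n; first by rewrite ffactn0.
case: n => [|n]; first by rewrite sub0n exp0n.
by rewrite subSS ffactSS expnS leq_mul// (leq_trans (leq_subr _ _)).
Qed.

(* Once its trace [C] on [A] is fixed, [B] is determined by [B :\: C]. *)
Lemma card_trace_le (T : finType) (A C : {set T}) (l : nat) :
  (#|[set B : {set T} | (#|B| == l) && (A :&: B == C)]| <= 'C(#|T|, l - #|C|))%N.
Proof.
rewrite -card_draws -(card_in_imset (f := fun B : {set T} => B :\: C)).
  apply/subset_leq_card/subsetP => D /imsetP[B].
  rewrite !inE => /andP[/eqP Bl /eqP BC] ->; rewrite cardsD Bl.
  by rewrite (setIidPr _)// -BC subsetIr.
move=> B B'; rewrite !inE => /andP[_ /eqP BC] /andP[_ /eqP BC'] eqD.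
have traceK D : A :&: D = C -> (D :\: C) :|: C = D.
  by move=> <-; apply/setP => x; rewrite !inE; case: (x \in A); case: (x \in D).
by rewrite -(traceK B)// -(traceK B')// eqD.
Qed.

Section BinomialBounds.
Variable R : realType.

Lemma bin_le_expR (n t : nat) : (0 < t)%N ->
  'C(n, t)%:R <= (expR 1 * n%:R / t%:R) ^+ t :> R.
Proof.
case: t => // t _.
have pow_gt0 : 0 < t.+1%:R ^+ t.+1 :> R by rewrite exprn_gt0.
have fact_gt0 : 0 < (t.+1)`!%:R :> R by rewrite ltr0n fact_gt0.
have pow_le_fact : t.+1%:R ^+ t.+1 <= (t.+1)`!%:R * expR 1 ^+ t.+1 :> R.
  rewrite -expRM_natl mulr1 mulrC -ler_pdivrMr//.
  by apply: le_trans (expR_ge1Dxn t _); rewrite ?lerDr ?ler01 ?ler0n.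
have bin_fact_le : 'C(n, t.+1)%:R * (t.+1)`!%:R <= n%:R ^+ t.+1 :> R.
  by rewrite -natrM bin_ffact -natrX ler_nat ffact_le_expn.
rewrite exprMn exprVn exprMn ler_pdivlMr// -(ler_pM2r fact_gt0) mulrAC.
apply: le_trans (ler_wpM2r (ltW pow_gt0) bin_fact_le) _.
by rewrite [leRHS]mulrAC [leRHS]mulrC ler_wpM2l ?exprn_ge0// mulrC.
Qed.

Lemma bin_ge_half_exp (m l : nat) : (2 * l <= m)%N ->
  (m%:R / 2) ^+ l / l`!%:R <= 'C(m, l)%:R :> R.
Proof.
move=> lm; rewrite ler_pdivrMr ?ltr0n ?fact_gt0// -natrM bin_ffact.
apply: (@le_trans _ _ ((m - l)%:R ^+ l)); last by rewrite -natrX ler_nat expn_subn_le_ffact.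
have : l%:R * 2 <= m%:R :> R by rewrite -natrM ler_nat mulnC.
by move=> lm'; rewrite lerXn2r ?nnegrE ?divr_ge0// natrB; [lra|lia].
Qed.

Lemma bin_subn_le (m l j : nat) : (l <= m)%N -> (j <= l)%N ->
  'C(m, l - j)%:R <= 'C(m, l)%:R * (l%:R / (m - l).+1%:R) ^+ j :> R.
Proof.
move=> lm; elim: j => [|j IH] jl; first by rewrite subn0 mulr1.
rewrite exprSr mulrA; apply: le_trans (ler_wpM2r _ (IH (ltnW jl))); last first.
  by rewrite divr_ge0.
rewrite mulrA ler_pdivlMr ?ltr0n// -!natrM ler_nat.
have bin_succ := mul_bin_left m (l - j.+1); rewrite subnSK// in bin_succ.
apply: (@leq_trans ('C(m, l - j.+1) * (m - (l - j.+1)))%N).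
  by rewrite leq_mul2l; apply/orP; right; lia.
by rewrite [leqLHS]mulnC -bin_succ mulnC leq_mul2l leq_subr orbT.
Qed.

(* Hypergeometric counterpart of the mean of [w ^+ X] for [X] binomial. *)
Lemma sumr_exp_cardI_le (T : finType) (w : R) (A : {set T}) : 0 <= w ->
  \sum_(B : {set T} | #|B| == #|A|) w ^+ #|A :&: B| <=
  'C(#|T|, #|A|)%:R * (1 + w * (#|A|%:R / (#|T| - #|A|).+1%:R)) ^+ #|A|.
Proof.
move=> w0; rewrite (partition_big (fun B => A :&: B) (fun C => C \subset A))/=; last first.
  by move=> B _; exact: subsetIl.
rewrite -sumr_exp_card_subset big_distrr/=; apply: ler_sum => C CA.
rewrite (eq_bigl (fun B : {set T} =>
  B \in [set B : {set T} | (#|B| == #|A|) && (A :&: B == C)])); last first.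
  by move=> B; rewrite inE.
under eq_bigr => B /[!inE] /andP[_ /eqP ->] do [].
rewrite sumr_const exprMn mulrCA -[leLHS]mulr_natr ler_wpM2l ?exprn_ge0//.
apply: le_trans (bin_subn_le (max_card _) (subset_leq_card CA)).
by rewrite ler_nat card_trace_le.
Qed.

End BinomialBounds.

(** * Finite laws *)

Definition is_pmf (R : numDomainType) (T : finType) (w : T -> R) : Prop :=
  (forall x, 0 <= w x) /\ \sum_x w x = 1.

Definition Pr (R : numDomainType) (T : finType) (w : T -> R) (E : pred T) : R :=
  \sum_(x | E x) w x.

Definition Ex (R : numDomainType) (T : finType) (w f : T -> R) : R :=
  \sum_x w x * f x.

Section FiniteLaw.
Variables (R : realFieldType) (T : finType) (w : T -> R).
Hypothesis w_pmf : is_pmf w.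
Implicit Types (E : pred T) (f : T -> R).

Let w_ge0 x : 0 <= w x. Proof. by case: w_pmf. Qed.

Lemma Ex_indicator E : Ex w (fun x => (E x)%:R) = Pr w E.
Proof. by rewrite /Pr big_mkcond; apply: eq_bigr => x _; case: (E x); rewrite ?mulr1 ?mulr0. Qed.

Lemma Ex_sum (I : finType) (Q : pred I) (F : I -> T -> R) :
  Ex w (fun x => \sum_(i | Q i) F i x) = \sum_(i | Q i) Ex w (F i).
Proof. by rewrite exchange_big; apply: eq_bigr => x _; rewrite big_distrr. Qed.

Lemma le_Ex f g : (forall x, f x <= g x) -> Ex w f <= Ex w g.
Proof. by move=> fg; apply: ler_sum => x _; rewrite ler_wpM2l. Qed.

Lemma Pr_ge0 E : 0 <= Pr w E.
Proof. exact: sumr_ge0. Qed.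

Lemma le_Pr E E' : (forall x, E x -> E' x) -> Pr w E <= Pr w E'.
Proof.
move=> EE'; rewrite -!Ex_indicator; apply: le_Ex => x.
by case: (boolP (E x)) => [/EE' ->|_]; rewrite ?lexx ?ler0n.
Qed.

Lemma PrC E : Pr w (fun x => ~~ E x) = 1 - Pr w E.
Proof. by case: w_pmf => _ <-; rewrite [in RHS](bigID E)/= addrAC subrr add0r. Qed.

Lemma PrI E E' :
  Pr w (fun x => E x && E' x) = Pr w E + Pr w E' - 1 + Pr w (fun x => ~~ E x && ~~ E' x).
Proof.
have PrE' : Pr w E' = Pr w (fun x => E x && E' x) + Pr w (fun x => ~~ E x && E' x).
  by rewrite /Pr (bigID E); congr (_ + _); apply: eq_bigl => x; rewrite andbC.
have PrCE : Pr w (fun x => ~~ E x) =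
    Pr w (fun x => ~~ E x && E' x) + Pr w (fun x => ~~ E x && ~~ E' x).
  by rewrite /Pr (bigID E').
by move: PrCE; rewrite PrC PrE' => PrCE; lra.
Qed.

Lemma Pr_le1 E : Pr w E <= 1.
Proof. by rewrite -subr_ge0 -PrC Pr_ge0. Qed.

Lemma Pr_exists_le (I : finType) (Q : pred I) (E : I -> pred T) :
  Pr w (fun x => [exists i, Q i && E i x]) <= \sum_(i | Q i) Pr w (E i).
Proof.
rewrite -Ex_indicator; under eq_bigr do rewrite -Ex_indicator.
rewrite -Ex_sum; apply: le_Ex => x.
case: existsP => [[i /andP[Qi Ei]]|_]; last exact: sumr_ge0.
by rewrite (bigD1 i)//= Ei lerDl sumr_ge0.
Qed.

Lemma Pr_exists_disjoint (I : finType) (Q : pred I) (E : I -> pred T) :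
  (forall i j x, E i x -> E j x -> i = j) ->
  Pr w (fun x => [exists i, Q i && E i x]) = \sum_(i | Q i) Pr w (E i).
Proof.
move=> disjE; rewrite -Ex_indicator; under eq_bigr do rewrite -Ex_indicator.
rewrite -Ex_sum; apply: eq_bigr => x _; congr (_ * _).
case: existsP => [[i /andP[Qi Ei]]|noE]; last first.
  by rewrite big1// => i Qi; case: (boolP (E i x)) => // Ei; case: noE; exists i; rewrite Qi.
rewrite (bigD1 i)//= Ei big1 ?addr0// => j /andP[_ ji].
by case: (boolP (E j x)) => // /(disjE _ _ _ Ei) ij; rewrite ij eqxx in ji.
Qed.

Lemma markov_ineq E f (a : R) : (forall x, 0 <= f x) -> (forall x, E x -> a <= f x) ->
  a * Pr w E <= Ex w f.
Proof.
move=> f0 af; rewrite /Pr big_distrr/= big_mkcond; apply: ler_sum => x _.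
case: ifP => [/af aE|_]; last by rewrite mulr_ge0.
by rewrite mulrC ler_wpM2l.
Qed.

Lemma Pr_eq0_sqr_Ex_le f :
  Pr w (fun x => f x == 0) * Ex w f ^+ 2 <= Ex w (fun x => f x ^+ 2) - Ex w f ^+ 2.
Proof.
have -> : Ex w (fun x => f x ^+ 2) - Ex w f ^+ 2 = Ex w (fun x => (f x - Ex w f) ^+ 2).
  set m := Ex w f; have wm : m ^+ 2 = \sum_x w x * m ^+ 2.
    by rewrite -big_distrl/= (proj2 w_pmf) mul1r.
  transitivity (Ex w (fun x => f x ^+ 2) - 2 * m * Ex w f + \sum_x w x * m ^+ 2).
    by rewrite -wm -/m; ring.
  by rewrite big_distrr/= -sumrN -!big_split/=; apply: eq_bigr => x _; ring.
rewrite mulrC; apply: markov_ineq => x; first exact: sqr_ge0.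
by move=> /eqP ->; rewrite sub0r sqrrN.
Qed.

Lemma Ex_sqr_count (I : finType) (E : I -> pred T) :
  Ex w (fun x => (\sum_i (E i x)%:R) ^+ 2) = \sum_i \sum_j Pr w (fun x => E i x && E j x).
Proof.
under [RHS]eq_bigr do under eq_bigr do rewrite -Ex_indicator.
under [RHS]eq_bigr do rewrite -Ex_sum.
rewrite -Ex_sum; apply: eq_bigr => x _; rewrite expr2 big_distrl/=; congr (_ * _).
apply: eq_bigr => i _; rewrite big_distrr/=; apply: eq_bigr => j _.
by rewrite -natrM mulnb.
Qed.

(* Chebyshev's inequality for the number of events that occur. *)
Lemma Pr_none_le (I : finType) (E : I -> pred T) (m r : R) :
  0 < #|I|%:R * m -> 0 <= r -> (forall i, Pr w (E i) = m) ->
  (forall i j, i != j -> Pr w (fun x => E i x && E j x) <= m ^+ 2 * r) ->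
  Pr w (fun x => [forall i, ~~ E i x]) <= (#|I|%:R * m)^-1 + (r - 1).
Proof.
set mu := #|I|%:R * m => mu_gt0 r0 PrE PrEE; pose count x : R := \sum_i (E i x)%:R.
have Ex_count : Ex w count = mu.
  by rewrite Ex_sum /mu mulr_natl -sumr_const; apply: eq_bigr => i _; rewrite Ex_indicator.
have row_le i : \sum_j Pr w (fun x => E i x && E j x) <= m + #|I|%:R * (m ^+ 2 * r).
  rewrite (bigD1 i)//= lerD//; first by rewrite -(PrE i); apply: le_Pr => x /andP[].
  rewrite mulr_natl -sumr_const big_mkcond; apply: ler_sum => j _.
  by case: ifPn => [ji|_]; [rewrite PrEE// eq_sym|rewrite mulr_ge0 ?sqr_ge0].
have Ex_sqr_le : Ex w (fun x => count x ^+ 2) <= mu + mu ^+ 2 * r.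
  rewrite Ex_sqr_count; apply: le_trans (ler_sum _ (fun i _ => row_le i)) _.
  by rewrite sumr_const -[leLHS]mulr_natl /mu; lra.
have := Pr_eq0_sqr_Ex_le count; rewrite Ex_count => chebyshev.
have none_le : Pr w (fun x => [forall i, ~~ E i x]) <= Pr w (fun x => count x == 0).
  by apply: le_Pr => x /forallP noE; rewrite /count big1// => i _; rewrite (negbTE (noE i)).
apply: le_trans none_le _; rewrite -(ler_pM2r (exprn_gt0 2 mu_gt0)); apply: le_trans chebyshev _.
rewrite (_ : _ * mu ^+ 2 = mu + mu ^+ 2 * r - mu ^+ 2) ?lerD2r//.
by field; rewrite gt_eqF.
Qed.

(* Events that are negatively dependent, in the sense that any [j] of them occur
   together with probability at most [u ^+ j], are dominated by independent ones. *)
Lemma Ex_prod_if_le (I : finType) (F : {set I}) (E : I -> pred T) (a u : R) :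
  0 <= a <= 1 ->
  (forall J : {set I}, J \subset F ->
     Pr w (fun x => [forall i in J, E i x]) <= u ^+ #|J|) ->
  Ex w (fun x => \prod_(i in F) (if E i x then 1 else a)) <= (a + (1 - a) * u) ^+ #|F|.
Proof.
move=> /andP[a0 a1] PrE.
have -> : Ex w (fun x => \prod_(i in F) (if E i x then 1 else a)) =
    \sum_(J : {set I} | J \subset F)
      (1 - a) ^+ #|J| * a ^+ #|F :\: J| * Pr w (fun x => [forall i in J, E i x]).
  transitivity (Ex w (fun x => \sum_(J : {set I} | J \subset F)
      (1 - a) ^+ #|J| * a ^+ #|F :\: J| * [forall i in J, E i x]%:R)).
    apply: eq_bigr => x _; congr (_ * _).
    rewrite (eq_bigr (fun i => (1 - a) * (E i x)%:R + a)); last first.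
      by move=> i _; case: (E i x); rewrite ?mulr1 ?subrK ?mulr0 ?add0r.
    rewrite prodrD_subset; apply: eq_bigr => J _.
    rewrite big_split/= !prodr_const mulrAC; congr (_ * _).
    case: forall_inP => [EJ|/forall_inP]; first by rewrite big1// => i /EJ ->.
    by rewrite negb_forall_in => /exists_inP[i iJ /negbTE Ei]; rewrite (bigD1 i)//= Ei mul0r.
  rewrite Ex_sum; apply: eq_bigr => J _; rewrite -Ex_indicator big_distrr/=.
  by apply: eq_bigr => x _; rewrite mulrCA.
rewrite [a + _]addrC -prodr_const prodrD_subset; apply: ler_sum => J JF.
rewrite !prodr_const exprMn [leRHS]mulrAC ler_wpM2l ?PrE//.
by rewrite mulr_ge0 ?exprn_ge0// subr_ge0.
Qed.

End FiniteLaw.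

(** * Elementary inequalities *)

Lemma bernoulli_ineq (R : realDomainType) (y : R) (m : nat) :
  0 <= y <= 1 -> 1 - m%:R * y <= (1 - y) ^+ m.
Proof.
move=> /andP[y0 y1]; elim: m => [|m IH]; first by rewrite mul0r subr0.
rewrite exprS; apply: le_trans (ler_wpM2l _ IH); last by rewrite subr_ge0.
have : 0 <= m%:R * y ^+ 2 by rewrite mulr_ge0// sqr_ge0.
by rewrite -natr1; nra.
Qed.

Lemma expr_onesub_itv (R : realDomainType) (y : R) (n m : nat) :
  0 <= y <= 1 -> 1 - n%:R * y <= (1 - y) ^+ (n - m) <= 1.
Proof.
move=> y01; have /andP[y0 y1] := y01; rewrite exprn_ile1 ?subr_ge0 ?andbT//.
  apply: le_trans (bernoulli_ineq (n - m) y01).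
  by rewrite lerB// ler_wpM2r// ler_nat leq_subr.
by rewrite lerBlDr lerDl.
Qed.

Lemma sumr_exp_pos_le (R : realFieldType) (y : R) (n : nat) (q : pred nat) :
  0 <= y <= 1 / 2 -> (forall t, q t -> (0 < t)%N) -> \sum_(t < n.+1 | q t) y ^+ t <= 2 * y.
Proof.
move=> /andP[y0 y_le] q_gt0.
apply: (@le_trans _ _ (\sum_(t < n.+1 | (0 < t)%N) y ^+ t)).
  rewrite big_mkcond [leRHS]big_mkcond/=; apply: ler_sum => t _.
  by case: ifP => [/q_gt0->//|_]; case: ifP => // _; exact: exprn_ge0.
rewrite big_mkcond big_ord_recl/= add0r.
under eq_bigr do rewrite exprS.
rewrite -big_distrr/= mulrC ler_wpM2r//.
have sum_ge0 : 0 <= \sum_(i < n) y ^+ i by apply: sumr_ge0 => i _; rewrite exprn_ge0.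
have := subrX1 y n; have := exprn_ge0 n y0.
by move: sum_ge0; set s := \sum_(i < n) _; nra.
Qed.

Section ExpLnBounds.
Variable R : realType.
Implicit Types (u x y t : R) (m l : nat).

Lemma onesub_expRN_ge u : 0 <= u -> u - u ^+ 2 <= 1 - expR (- u).
Proof.
move=> u0; have inv_exp := expRxMexpNx_1 u; have exp_ge := expR_ge1Dx u.
have expN_gt0 := expR_gt0 (- u).
have : expR (- u) * (1 + u) <= 1 by nra.
have : 0 <= u ^+ 3 by rewrite exprn_ge0.
by nra.
Qed.

Lemma expr_onesub_le_expR u m : u <= 1 -> (1 - u) ^+ m <= expR (- (m%:R * u)).
Proof.
move=> u1; rewrite -mulrN expRM_natl lerXn2r ?nnegrE ?expR_ge0 ?subr_ge0//.
exact: expR_ge1Dx.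
Qed.

Lemma expRN_div_onesub_le y : y < 1 -> expR (- (y / (1 - y))) <= 1 - y.
Proof.
move=> y1; have y0 : 0 < 1 - y by rewrite subr_gt0.
rewrite expRN invf_ple ?posrE ?expR_gt0//; apply: le_trans (expR_ge1Dx _).
by rewrite [leRHS](_ : _ = (1 - y)^-1)//; field; rewrite gt_eqF.
Qed.

Lemma sqr_le_expR x : 24 <= x -> 4 * x ^+ 2 <= expR x.
Proof.
move=> x24; apply: le_trans (@expR_ge1Dxn R x 2 _); last by lra.
have := sqr_ge0 x; rewrite (_ : 3`!%:R = 6 :> R)// [x ^+ 3]exprSr.
by move: (x ^+ 2) => u u0; nra.
Qed.

(* [(1 + ln x) / x] is nonincreasing on [x >= 1]. *)
Lemma mulr_1Dln_le t u : 1 <= t -> t <= u -> t * (1 + ln u) <= u * (1 + ln t).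
Proof.
move=> t1 tu; have t0 : 0 < t by lra.
have u0 : 0 < u by lra.
have lnD : ln u <= ln t + (u / t - 1).
  rewrite -lerBlDl -ln_div ?posrE//.
  by apply: le_trans (le_ln1Dx _); rewrite ?subrKC// ltrBDl subrr divr_gt0.
have : t * ln u <= t * ln t + (u - t).
  by rewrite (_ : _ + _ = t * (ln t + (u / t - 1))) ?ler_pM2l//; field; rewrite gt_eqF.
by have := ln_ge0 t1; nra.
Qed.

Lemma mulr_ln_le_div8 l x : expR (16 * l%:R) <= x -> 0 <= l%:R * ln x <= x / 8.
Proof.
move=> lx; have x0 : 0 < x by apply: lt_le_trans lx; exact: expR_gt0.
have lnx_ge : 16 * l%:R <= ln x by rewrite -[leLHS]expRK ler_ln ?posrE ?expR_gt0.
have l0 : 0 <= l%:R :> R by [].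
have lnx0 : 0 <= ln x by lra.
rewrite mulr_ge0//=; have := @expR_ge1Dxn R (ln x) 1 lnx0.
by rewrite lnK ?posrE// (_ : 2`!%:R = 2 :> R)//; nra.
Qed.

End ExpLnBounds.

(** * Random subsets and the holders of an object *)

Definition subset_pmf (R : realFieldType) (V : finType) (p : R) (H : {set V}) : R :=
  \prod_i (if i \in H then p else 1 - p).

Definition pair_prob (R : realFieldType) (n : nat) (p : R) : R :=
  p ^+ 2 * (1 - p) ^+ (n - 2).

Lemma pair_prob_itv (R : realFieldType) (n : nat) (p : R) :
  0 <= p <= 1 -> 0 <= pair_prob n p <= 1.
Proof.
move=> /andP[p0 p1]; rewrite mulr_ge0 ?exprn_ge0 ?subr_ge0//=.
by rewrite mulr_ile1 ?exprn_ge0 ?exprn_ile1 ?subr_ge0// lerBlDr lerDl.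
Qed.

Section RandomSubset.
Variables (R : realFieldType) (V : finType) (p : R).
Hypothesis p01 : 0 <= p <= 1.
Implicit Types (H I : {set V}) (i j : V).

Lemma subset_pmfE H : subset_pmf p H = p ^+ #|H| * (1 - p) ^+ (#|V| - #|H|).
Proof. exact: prodr_if_mem. Qed.

Lemma subset_pmf_pair i j : i != j -> subset_pmf p [set i; j] = pair_prob #|V| p.
Proof. by move=> ij; rewrite subset_pmfE cards2 ij. Qed.

Lemma Pr_supset I : Pr (subset_pmf p) (fun H => I \subset H) = p ^+ #|I|.
Proof.
transitivity (\prod_i (p + if i \in I then 0 else 1 - p)).
  rewrite (@bigA_distr R 0 1 *%R +%R)/= [LHS]big_mkcond/=; apply: eq_bigr => H _.
  case: ifPn => [/subsetP IH|/subsetPn[i iI iH]]; last first.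
    by rewrite (bigD1 i)//= (negbTE iH) iI mul0r.
  apply: eq_bigr => i _; case: ifPn => // iH.
  by case: ifPn => // /IH; rewrite (negbTE iH).
rewrite -prodr_const [RHS]big_mkcond/=; apply: eq_bigr => i _.
by case: ifP => _; rewrite ?addr0 ?subrKC.
Qed.

Lemma Pr_mem i : Pr (subset_pmf p) (fun H => i \in H) = p.
Proof.
by rewrite -[RHS]expr1 -(cards1 i) -Pr_supset; apply: eq_bigl => H; rewrite sub1set.
Qed.

Lemma Pr_mem2 i j : i != j -> Pr (subset_pmf p) (fun H => (i \in H) && (j \in H)) = p ^+ 2.
Proof.
move=> ij; have := Pr_supset [set i; j]; rewrite cards2 ij => <-.
by apply: eq_bigl => H; rewrite subUset !sub1set.
Qed.

Lemma subset_pmf_is_pmf : is_pmf (@subset_pmf R V p).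
Proof.
have /andP[p0 p1] := p01; split=> [H|].
  by apply: prodr_ge0 => i _; case: ifP; rewrite ?subr_ge0.
by rewrite -[RHS](expr0 p) -(cards0 V) -Pr_supset; apply: eq_bigl => H; rewrite sub0set.
Qed.

End RandomSubset.

Definition holders (A B : finType) (S : {ffun A -> {set B}}) : {ffun B -> {set A}} :=
  [ffun o => [set i | o \in S i]].

Lemma in_holders (A B : finType) (S : {ffun A -> {set B}}) i o :
  (i \in holders S o) = (o \in S i).
Proof. by rewrite ffunE inE. Qed.

Lemma holdersK (A B : finType) : cancel (@holders A B) (@holders B A).
Proof. by move=> S; apply/ffunP => i; apply/setP => o; rewrite !in_holders. Qed.

Section HoldersLaw.
Variables (R : realType) (n P : nat) (p : R).

Lemma object_sets_pmf_holders (S : {ffun 'I_n -> {set 'I_P}}) :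
  object_sets_pmf p S = \prod_o subset_pmf p (holders S o).
Proof.
rewrite /object_sets_pmf exchange_big/=; apply: eq_bigr => o _.
by apply: eq_bigr => i _; rewrite in_holders.
Qed.

Lemma object_sets_pmf_is_pmf : 0 <= p <= 1 -> is_pmf (@object_sets_pmf R n P p).
Proof. by move=> p01; split=> [S|]; [exact: object_sets_pmf_ge0|exact: Gb_prob_total]. Qed.

Lemma Pr_forall_holders (q : 'I_P -> pred {set 'I_n}) :
  Pr (object_sets_pmf p) (fun S => [forall o, q o (holders S o)]) =
  \prod_o Pr (subset_pmf p) (q o).
Proof.
rewrite /Pr (reindex (@holders _ _)); last by exists (@holders _ _) => ? _; rewrite holdersK.
under [RHS]eq_bigr do rewrite big_mkcond.
rewrite bigA_distr_bigA big_mkcond; apply: eq_bigr => H _.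
rewrite object_sets_pmf_holders holdersK.
case: ifPn => [/forallP qH|/forallPn[obj /negbTE qo]]; last by rewrite (bigD1 obj)//= qo mul0r.
by apply: eq_bigr => o _; rewrite qH.
Qed.

Lemma Gb_probE (E : rel 'I_n -> bool) :
  Gb_prob P p E = Pr (object_sets_pmf p) (fun S => E (@intersection_adj n P S)).
Proof. by []. Qed.

Lemma Gb_prob_itv (E : rel 'I_n -> bool) : 0 <= p <= 1 -> 0 <= Gb_prob P p E <= 1.
Proof.
move=> p01; have law := object_sets_pmf_is_pmf p01.
by rewrite Gb_probE Pr_ge0// Pr_le1.
Qed.

End HoldersLaw.

Lemma intersection_adjP (n P : nat) (S : {ffun 'I_n -> {set 'I_P}}) (i j : 'I_n) :
  reflect (i != j /\ exists o, [set i; j] \subset holders S o) (intersection_adj S i j).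
Proof.
apply: (iffP andP) => -[ij]; last first.
  case=> o; rewrite subUset !sub1set !in_holders => /andP[oi oj].
  by split=> //; apply/set0Pn; exists o; rewrite inE oi.
move=> /set0Pn[obj]; rewrite inE => /andP[oi oj]; split=> //; exists obj.
by rewrite subUset !sub1set !in_holders oi.
Qed.

(** * Cuts with few edges *)

Definition sparse_cut (V : finType) (adj : rel V) (l : nat) (T : {set V}) : bool :=
  [forall i in T, (#|[set j in ~: T | adj i j]| <= l)%N].

Lemma not_k_robust_sparse_cut (V : finType) (adj : rel V) (l : nat) :
  ~~ k_robust adj l.+1 ->
  exists T : {set V}, [/\ (0 < #|T|)%N, (2 * #|T| <= #|V|)%N & sparse_cut adj l T].
Proof.
rewrite negb_forall => /existsP[T].
rewrite negb_imply negb_or => /andP[/andP[T0 TT] /andP[]].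
rewrite !negb_exists_in => /forall_inP cutT /forall_inP cutC.
have cardT := cardsC T.
have [le_half|gt_half] := leqP (2 * #|T|) #|V|.
  by exists T; split; rewrite ?card_gt0//; apply/forall_inP => i /cutT; rewrite -ltnNge.
exists (~: T); split; last first.
- by apply/forall_inP => i /cutC; rewrite setCK -ltnNge.
- by lia.
- by rewrite card_gt0; apply: contra TT => /eqP CT; rewrite -(setCK T) CT setC0.
Qed.

Lemma k_robust_min_degree (V : finType) (adj : rel V) (k : nat) (x : V) :
  symmetric adj -> irreflexive adj -> (1 < #|V|)%N ->
  k_robust adj k -> (k <= #|[set y | adj x y]|)%N.
Proof.
move=> adjC adjxx V1 /forallP/(_ [set x])/implyP.
have -> : ([set x] != set0) && ([set x] != [set: V]).
  apply/andP; split; first by apply/set0Pn; exists x; rewrite inE.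
  by apply/eqP => xT; move: V1; rewrite -cardsT -xT cards1.
move=> /(_ isT)/orP[] /exists_inP[y]; rewrite !inE.
  move=> /eqP-> /leq_trans; apply; apply/subset_leq_card/subsetP => z.
  by rewrite !inE => /andP[].
move=> _ /leq_trans; apply; have [xy|xy] := boolP (adj x y).
  apply: (@leq_trans #|[set x]|); last first.
    by rewrite cards1 card_gt0; apply/set0Pn; exists y; rewrite inE.
  by apply/subset_leq_card/subsetP => z; rewrite !inE => /andP[].
rewrite (_ : [set _ in _ | _] = set0) ?cards0//; apply/setP => z; rewrite !inE.
by apply/andP => -[/eqP ->]; rewrite adjC (negbTE xy).
Qed.

Lemma card_sparse_cut (V : finType) (adj : rel V) (l : nat) (T : {set V}) :
  sparse_cut adj l T -> (#|[set e in setX T (~: T) | adj e.1 e.2]| <= l * #|T|)%N.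
Proof.
move=> /forall_inP few; rewrite mulnC -sum_nat_const -sum1_card.
rewrite (eq_bigl (fun e => (e.1 \in T) && ((e.2 \in ~: T) && adj e.1 e.2))); last first.
  by move=> e; rewrite !inE andbA.
rewrite -(pair_big_dep (mem T) (fun i j => (j \in ~: T) && adj i j) (fun _ _ => 1%N))/=.
apply: leq_sum => i /few; rewrite -sum1_card; apply: leq_trans.
by apply: eq_leq; apply: eq_bigl => j; rewrite !inE.
Qed.

Lemma set2_cut_inj (V : finType) (T : {set V}) :
  {in setX T (~: T) &, injective (fun e : V * V => [set e.1; e.2])}.
Proof.
have cut_trace (i j : V) : i \in T -> j \notin T ->
    ([set i; j] :&: T = [set i]) * ([set i; j] :\: T = [set j]).
  move=> iT jT; split; apply/setP => x; rewrite !inE.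
    by case: (eqVneq x i) => [->|_]//=; case: (eqVneq x j) => [->|_]//=; rewrite (negbTE jT).
  case: (eqVneq x j) => [->|_]; rewrite ?orbT ?orbF ?jT//.
  by case: eqP => [->|_]; rewrite ?iT ?andbF.
move=> [i j] [i' j'] /setXP[/= iT]; rewrite inE => jT /setXP[/= iT']; rewrite inE => jT' eq2.
have [tr1 tr2] := cut_trace i j iT jT; rewrite eq2 !cut_trace// in tr1 tr2.
by rewrite (set1_inj tr1) (set1_inj tr2).
Qed.

Definition pair_unused (A B : finType) (S : {ffun A -> {set B}}) (e : A * A) : bool :=
  [forall o, holders S o != [set e.1; e.2]].

Lemma nonadj_pair_unused (n P : nat) (S : {ffun 'I_n -> {set 'I_P}}) (e : 'I_n * 'I_n) :
  e.1 != e.2 -> ~~ intersection_adj S e.1 e.2 -> pair_unused S e.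
Proof.
move=> e12; apply: contraR => /forallPn[obj]; rewrite negbK => /eqP eqo.
by apply/intersection_adjP; split=> //; exists obj; rewrite eqo.
Qed.

Section SparseCutLaw.
Variables (R : realType) (n P : nat) (p : R).
Hypothesis p01 : 0 <= p <= 1.
Implicit Types (T : {set 'I_n}) (x : R).

Let beta : R := pair_prob n p.

Lemma Pr_cut_pairs T (J : {set 'I_n * 'I_n}) : J \subset setX T (~: T) ->
  Pr (subset_pmf p) (fun H => H \in (fun e => [set e.1; e.2]) @: J) = #|J|%:R * beta.
Proof.
move=> /subsetP JT.
rewrite mulr_natl -(card_in_imset (sub_in2 JT (@set2_cut_inj _ T))) -sumr_const.
apply: eq_bigr => _ /imsetP[[i j] /JT/setXP[/= iT jT] ->].
by rewrite subset_pmf_pair ?card_ord//; apply: contraTneq jT => <-; rewrite inE iT.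
Qed.

(* The [#|J|] pairs compete for the same objects: each object misses all of them
   with probability [1 - #|J| * beta <= (1 - beta) ^+ #|J|]. *)
Lemma Pr_pairs_unused_le T (J : {set 'I_n * 'I_n}) : J \subset setX T (~: T) ->
  Pr (@object_sets_pmf R n P p) (fun S => [forall e in J, pair_unused S e]) <=
  ((1 - beta) ^+ P) ^+ #|J|.
Proof.
move=> JT; have used_prob := Pr_cut_pairs JT; have subset_law := @subset_pmf_is_pmf R 'I_n p p01.
have /andP[beta0 beta1] : 0 <= beta <= 1 := pair_prob_itv n p01.
rewrite exprAC (_ : Pr _ _ = (1 - #|J|%:R * beta) ^+ P).
  rewrite lerXn2r ?nnegrE ?exprn_ge0 ?bernoulli_ineq ?beta0 ?subr_ge0//.
  by rewrite -used_prob Pr_le1.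
rewrite -used_prob -PrC// -[X in _ ^+ X]card_ord -prodr_const.
rewrite -(Pr_forall_holders p (fun _ H => H \notin _ @: J)).
apply: eq_bigl => S; apply/forall_inP/forallP => [unused o|used e eJ].
  by apply/imsetP => -[e /unused/forallP/(_ o)/eqP].
by apply/forallP => o; apply: contra (used o) => /eqP ->; exact: imset_f.
Qed.

Lemma Pr_sparse_cut_le (l : nat) (x : R) T : 0 < x <= 1 ->
  Pr (@object_sets_pmf R n P p) (fun S => sparse_cut (intersection_adj S) l T) <=
  (x ^- l * (x + (1 - x) * (1 - beta) ^+ P) ^+ (n - #|T|)) ^+ #|T|.
Proof.
move=> /andP[x0 x1]; have law := object_sets_pmf_is_pmf n P p01.
have card_cut : #|setX T (~: T)| = ((n - #|T|) * #|T|)%N.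
  by rewrite cardsX mulnC [#|~: T|]cardsCs setCK card_ord.
rewrite exprMn exprVn mulrC ler_pdivlMr ?exprn_gt0// -!exprM -card_cut mulrC.
apply: (le_trans _ (Ex_prod_if_le _ (@Pr_pairs_unused_le T))); last by rewrite ltW.
apply: markov_ineq => // S.
  by apply: prodr_ge0 => e _; case: ifP => // _; exact: ltW.
move=> /card_sparse_cut few; apply: (@le_trans _ _
    (\prod_(e in setX T (~: T)) (if intersection_adj S e.1 e.2 then x else 1))).
  rewrite -big_mkcondr/= prodr_const ler_wiXn2l ?(ltW x0)//; apply: leq_trans few.
  by apply/subset_leq_card/subsetP => e; rewrite [in X in _ -> X]inE.
apply: ler_prod => -[i j] /setXP[iT jT]; case: ifPn => [_|nadj].
  by rewrite (ltW x0)/=; case: ifP.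
by rewrite ler01 nonadj_pair_unused//=; apply: contraTneq jT => <-; rewrite inE iT.
Qed.

Lemma Gb_prob_not_k_robust_le (l : nat) (x : R) : 0 < x <= 1 ->
  1 - Gb_prob P p (fun adj : rel 'I_n => k_robust adj l.+1) <=
  \sum_(t < n.+1 | (0 < t)%N && (2 * t <= n)%N) 'C(n, t)%:R *
    (x ^- l * (x + (1 - x) * (1 - beta) ^+ P) ^+ (n - t)) ^+ t.
Proof.
move=> x01; have law := object_sets_pmf_is_pmf n P p01.
have := sumr_by_card 'I_n (fun t => (0 < t)%N && (2 * t <= n)%N)
  (fun t => (x ^- l * (x + (1 - x) * (1 - beta) ^+ P) ^+ (n - t)) ^+ t).
rewrite card_ord => <-; rewrite Gb_probE -PrC//.
apply: le_trans (ler_sum _ (fun T _ => Pr_sparse_cut_le l T x01)).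
apply: le_trans (Pr_exists_le law _ _); apply: le_Pr => // S.
move=> /not_k_robust_sparse_cut[T [T0 Tn cutT]]; apply/existsP; exists T.
by rewrite T0 cutT -[X in (_ <= X)%N]card_ord Tn.
Qed.

End SparseCutLaw.

(** * Nodes of low degree *)

Definition paired_prob (R : realFieldType) (n : nat) (p : R) : R :=
  (n%:R - 1) * pair_prob n p.

Definition unshared_prob (R : realFieldType) (n : nat) (p : R) : R :=
  1 - p + p * (1 - p) ^+ (n - 1).

Definition paired (V : finType) (i : V) (H : {set V}) : bool := (i \in H) && (#|H| == 2).

Definition unshared (V : finType) (i : V) (H : {set V}) : bool :=
  ~~ ((i \in H) && (1 < #|H|)%N).

Section PairedUnshared.
Variables (R : realFieldType) (V : finType) (p : R).
Hypothesis p01 : 0 <= p <= 1.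
Implicit Types (i j : V).

Let law : is_pmf (@subset_pmf R V p). Proof. exact: subset_pmf_is_pmf. Qed.

Lemma unshared_prob_itv (n : nat) : 1 - n%:R * p ^+ 2 <= unshared_prob n p <= 1.
Proof.
have /andP[p0 p1] := p01; have /andP[c_ge c1] := expr_onesub_itv n 1 p01.
rewrite /unshared_prob; have := ler_wpM2l p0 c1; have := ler_wpM2l p0 c_ge; lra.
Qed.

Lemma Pr_paired i : Pr (subset_pmf p) (paired i) = paired_prob #|V| p.
Proof.
pose pair j := [set i; j]; have pair_inj : {in [set~ i] &, injective pair}.
  move=> j j'; rewrite !inE => ji j'i /setP/(_ j).
  by rewrite !inE eqxx orbT (negbTE ji) => /esym/eqP.
transitivity (\sum_(H in pair @: [set~ i]) pair_prob #|V| p); last first.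
  have V_gt0 : (0 < #|V|)%N by apply/card_gt0P; exists i.
  rewrite sumr_const card_in_imset// cardsC1 -[LHS]mulr_natl.
  by rewrite -subn1 natrB.
apply: eq_big => [H|H /andP[iH /cards2P[x [y [xy ->]]]]]; last exact: subset_pmf_pair.
apply/andP/imsetP => [[iH /cards2P[x [y [xy HE]]]]|[j]]; last first.
  by rewrite !inE => ji ->; rewrite !inE eqxx cards2 eq_sym ji.
move: iH; rewrite HE !inE => /orP[]/eqP ii.
  by exists y; rewrite ?inE /pair ii// eq_sym.
by exists x; rewrite ?inE /pair ii// setUC.
Qed.

Lemma Pr_paired2_le i j : i != j ->
  Pr (subset_pmf p) (fun H => paired i H && paired j H) <= pair_prob #|V| p.
Proof.
move=> ij; rewrite -(subset_pmf_pair p ij) -[leRHS](big_pred1_eq +%R [set i; j]).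
apply: (le_Pr law) => H /andP[/andP[iH /eqP H2] /andP[jH _]] /=.
by rewrite eq_sym eqEcard cards2 ij H2 leqnn subUset !sub1set iH jH.
Qed.

Lemma Pr_unshared i : Pr (subset_pmf p) (unshared i) = unshared_prob #|V| p.
Proof.
have Pr_single : Pr (subset_pmf p) (fun H => (i \in H) && ~~ (1 < #|H|)%N) =
    p * (1 - p) ^+ (#|V| - 1).
  rewrite /Pr (big_pred1 [set i]) => [|H]; first by rewrite subset_pmfE cards1.
  rewrite -leqNgt; apply/andP/eqP => [[iH H1]|->]; last by rewrite inE eqxx cards1.
  by apply/esym/eqP; rewrite eqEcard sub1set iH cards1.
have split_mem : p = Pr (subset_pmf p) (fun H => (i \in H) && (1 < #|H|)%N) +
    p * (1 - p) ^+ (#|V| - 1).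
  by rewrite -Pr_single -[LHS](Pr_mem p i) /Pr (bigID (fun H : {set V} => 1 < #|H|)%N).
by rewrite PrC// /unshared_prob; lra.
Qed.

Lemma Pr_unshared2_le i j : i != j ->
  Pr (subset_pmf p) (fun H => unshared i H && unshared j H) <=
  unshared_prob #|V| p ^+ 2 + p ^+ 2.
Proof.
move=> ij; rewrite PrI// !Pr_unshared -(Pr_mem2 p ij).
have : Pr (subset_pmf p) (fun H => ~~ unshared i H && ~~ unshared j H) <=
    Pr (subset_pmf p) (fun H => (i \in H) && (j \in H)).
  by apply: (le_Pr law) => H; rewrite !negbK => /andP[/andP[-> _] /andP[-> _]].
by have := sqr_ge0 (unshared_prob #|V| p - 1); lra.
Qed.

Lemma Pr_unshared2_ge i j :
  1 - 2 * (#|V|%:R * p ^+ 2) <=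
  Pr (subset_pmf p) (fun H => unshared i H && unshared j H).
Proof.
rewrite PrI// !Pr_unshared; have /andP[a_ge _] := unshared_prob_itv #|V|.
have := Pr_ge0 law (fun H => ~~ unshared i H && ~~ unshared j H); lra.
Qed.

End PairedUnshared.

Definition linked_by (V O : finType) (A : {set O}) (i : V) (S : {ffun V -> {set O}}) : bool :=
  [forall o, if o \in A then paired i (holders S o) else unshared i (holders S o)].

Definition has_links (V O : finType) (l : nat) (i : V) (S : {ffun V -> {set O}}) : bool :=
  [exists A : {set O}, (#|A| == l) && linked_by A i S].

Lemma linked_by_inj (V O : finType) (A B : {set O}) (i : V) (S : {ffun V -> {set O}}) :
  linked_by A i S -> linked_by B i S -> A = B.
Proof.
move=> /forallP SA /forallP SB; apply/setP => o; have := SA o; have := SB o.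
rewrite /paired /unshared; do 2 case: ifP => //; move=> _ _.
all: by case: (i \in _) => //=; case: eqP => // ->.
Qed.

Lemma has_links_degree_le (n P l : nat) (i : 'I_n) (S : {ffun 'I_n -> {set 'I_P}}) :
  has_links l i S -> (#|[set j | intersection_adj S i j]| <= l)%N.
Proof.
move=> /existsP[A /andP[/eqP <- /forallP SA]].
apply: (@leq_trans #|\bigcup_(o in A) (holders S o :\ i)|).
  apply/subset_leq_card/subsetP => j; rewrite inE => /intersection_adjP[ij [obj ijo]].
  have [io jo] : i \in holders S obj /\ j \in holders S obj.
    by move: ijo; rewrite subUset !sub1set => /andP.
  apply/bigcupP; exists obj; last by rewrite !inE eq_sym ij jo.
  apply: contraT => oA; have := SA obj; rewrite (negbTE oA) /unshared io/=.
  by move/subset_leq_card: ijo; rewrite cards2 ij => ->.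
rewrite -[leqRHS]sum1_card.
apply: (big_ind2 (fun (U : {set 'I_n}) m => #|U| <= m)%N); first by rewrite cards0.
  by move=> U u W v Uu Wv; apply: leq_trans (leq_add Uu Wv); rewrite cardsU leq_subr.
move=> o oA; have := SA o; rewrite oA => /andP[io /eqP].
by rewrite (cardsD1 i) io add1n => -[->].
Qed.

(* How much likelier an object is to link both of two given nodes than if it
   linked each of them independently. *)
Definition link_ratio (R : realFieldType) (n : nat) (p : R) : R :=
  pair_prob n p / paired_prob n p ^+ 2.

Definition overlap_factor (R : realFieldType) (n P l : nat) (p : R) : R :=
  (1 + link_ratio n p * (l%:R / (P - l).+1%:R)) ^+ l.

Lemma link_ratio_ge0 (R : realFieldType) (n : nat) (p : R) :
  0 <= p <= 1 -> 0 <= link_ratio n p.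
Proof. by move=> /(pair_prob_itv n)/andP[beta0 _]; rewrite mulr_ge0// invr_ge0 sqr_ge0. Qed.

Lemma overlap_factor_ge0 (R : realFieldType) (n P l : nat) (p : R) :
  0 <= p <= 1 -> 0 <= overlap_factor n P l p.
Proof. by move=> p01; rewrite exprn_ge0 ?addr_ge0// mulr_ge0 ?link_ratio_ge0 ?divr_ge0. Qed.

Section LinksLaw.
Variables (R : realType) (n P l : nat) (p : R).
Hypothesis p01 : 0 <= p <= 1.
Implicit Types (A B : {set 'I_P}) (i j : 'I_n).

Let law : is_pmf (@object_sets_pmf R n P p). Proof. exact: object_sets_pmf_is_pmf. Qed.
Let subset_law : is_pmf (@subset_pmf R 'I_n p). Proof. exact: subset_pmf_is_pmf. Qed.
Let beta : R := pair_prob n p.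
Let gamma : R := paired_prob n p.

Lemma Pr_has_links i :
  Pr (@object_sets_pmf R n P p) (has_links l i) =
  'C(P, l)%:R * (gamma ^+ l * unshared_prob n p ^+ (P - l)).
Proof.
rewrite Pr_exists_disjoint => [|A B S]; last exact: linked_by_inj.
rewrite -[P in 'C(P, _)]card_ord -sumr_card_const; apply: eq_bigr => A /eqP <-.
rewrite /linked_by (Pr_forall_holders p
  (fun o H => if o \in A then paired i H else unshared i H)).
rewrite -[P in (P - _)%N]card_ord -prodr_if_mem; apply: eq_bigr => o _.
by case: ifP => _; [have := Pr_paired p i|have := Pr_unshared p01 i]; rewrite card_ord.
Qed.

Let w : R := link_ratio n p.
Let w_ge0 : 0 <= w. Proof. exact: link_ratio_ge0. Qed.

Section TwoNodes.
Variables i j : 'I_n.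
Hypothesis ij : i != j.
Hypothesis gamma_gt0 : 0 < gamma.
Let r : R := Pr (subset_pmf p) (fun H => unshared i H && unshared j H).
Hypothesis r_gt0 : 0 < r.

Lemma Pr_linked_by2_le A B :
  Pr (@object_sets_pmf R n P p) (fun S => linked_by A i S && linked_by B j S) <=
  r ^+ P * ((gamma / r) ^+ #|A| * (gamma / r) ^+ #|B|) * w ^+ #|A :&: B|.
Proof.
have r_le1 : r <= 1 by exact: Pr_le1.
have gw : gamma ^+ 2 * w = beta by rewrite /w /link_ratio mulrC divfK// expf_eq0/= gt_eqF.
pose test o (H : {set 'I_n}) := (if o \in A then paired i H else unshared i H) &&
  (if o \in B then paired j H else unshared j H).
rewrite (_ : Pr _ _ = \prod_(o < P) Pr (subset_pmf p) (test o)); last first.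
  rewrite -Pr_forall_holders; apply: eq_bigl => S; apply/andP/forallP.
    by move=> [/forallP SA /forallP SB] o; rewrite /test SA SB.
  by move=> SAB; split; apply/forallP => o; have /andP[] := SAB o.
rewrite [leRHS](_ : _ = \prod_(o < P) (r * ((if o \in A then gamma / r else 1) *
    (if o \in B then gamma / r else 1)) * (if o \in A :&: B then w else 1))); last first.
  by rewrite !big_split/= prodr_const card_ord !prodr_if_mem !expr1n !mulr1.
have paired_le i' (q : pred {set 'I_n}) : (forall H, q H -> paired i' H) ->
    Pr (subset_pmf p) q <= gamma.
  by move=> /(le_Pr subset_law); rewrite Pr_paired card_ord.
apply: ler_prod => o _; rewrite Pr_ge0//= /test inE.
case: (o \in A); case: (o \in B) => /=; rewrite ?mulr1 ?mul1r.
- apply: le_trans (Pr_paired2_le p01 ij) _; rewrite card_ord -/beta -gw ler_wpM2r//.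
  rewrite [leRHS](_ : _ = gamma ^+ 2 * r^-1); last by field; rewrite gt_eqF.
  by rewrite ler_peMr ?exprn_ge0 ?invf_ge1// ltW.
- by rewrite mulrC divfK ?gt_eqF// (paired_le i)// => H /andP[].
- by rewrite mulrC divfK ?gt_eqF// (paired_le j)// => H /andP[].
- by [].
Qed.

Lemma Pr_has_links2_le :
  Pr (@object_sets_pmf R n P p) (fun S => has_links l i S && has_links l j S) <=
  ('C(P, l)%:R * gamma ^+ l) ^+ 2 *
    (r ^+ P / r ^+ (2 * l) * overlap_factor n P l p).
Proof.
apply: (@le_trans _ _ (\sum_(A : {set 'I_P} | #|A| == l) \sum_(B : {set 'I_P} | #|B| == l)
    Pr (@object_sets_pmf R n P p) (fun S => linked_by A i S && linked_by B j S))).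
  rewrite pair_big; apply: le_trans (Pr_exists_le law _ _).
  apply: le_Pr => // S /andP[/existsP[A /andP[Al SA]] /existsP[B /andP[Bl SB]]].
  by apply/existsP; exists (A, B); rewrite /= Al SA Bl.
apply: (@le_trans _ _ (\sum_(A : {set 'I_P} | #|A| == l)
    r ^+ P * (gamma / r) ^+ (2 * l) * ('C(P, l)%:R * overlap_factor n P l p))).
  apply: ler_sum => A /eqP Al.
  apply: (@le_trans _ _ (\sum_(B : {set 'I_P} | #|B| == l)
      r ^+ P * (gamma / r) ^+ (2 * l) * w ^+ #|A :&: B|)).
    apply: ler_sum => B /eqP Bl; apply: le_trans (Pr_linked_by2_le A B) _.
    by rewrite Al Bl -exprD addnn mul2n.
  rewrite -big_distrr ler_wpM2l//; first by rewrite mulr_ge0 ?exprn_ge0 ?divr_ge0 ?ltW.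
  by have := sumr_exp_cardI_le A w_ge0; rewrite Al card_ord.
rewrite sumr_card_const card_ord expr_div_n [leLHS](_ : _ =
  ('C(P, l)%:R * gamma ^+ l) ^+ 2 * (r ^+ P / r ^+ (2 * l) * overlap_factor n P l p))//.
by rewrite [gamma ^+ (2 * l)]exprM exprAC; ring.
Qed.

End TwoNodes.

Lemma Gb_prob_k_robust_le_none : (1 < n)%N ->
  Gb_prob P p (fun adj : rel 'I_n => k_robust adj l.+1) <=
  Pr (@object_sets_pmf R n P p) (fun S => [forall i : 'I_n, ~~ has_links l i S]).
Proof.
move=> n1; rewrite Gb_probE; apply: le_Pr => // S robS; apply/forallP => i.
apply/negP => /has_links_degree_le; apply/negP; rewrite -ltnNge.
apply: k_robust_min_degree robS; rewrite ?card_ord//.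
- by move=> x y; rewrite /intersection_adj eq_sym setIC.
- by move=> x; rewrite /intersection_adj eqxx.
Qed.

End LinksLaw.

(** * Finite bounds near the threshold *)

(* Two nodes share [p ^+ 2 * P] objects on average, so this is asymptotically the
   mean degree. *)
Definition mean_degree (R : realType) (n P : nat) (p : R) : R := n%:R * (p ^+ 2 * P%:R).

(* Up to a factor depending on [l] only, the mean number of nodes of degree [l]
   when the mean degree is [d]. *)
Definition low_degree_scale (R : realType) (n l : nat) (d : R) : R :=
  n%:R * ln n%:R ^+ l * expR (- d).

Record critical_window (R : realType) (n P l : nat) (p : R) : Prop := CriticalWindow {
  window_ln : 24 <= ln (n%:R : R);
  window_mean_ge : 3 / 4 * ln n%:R <= mean_degree n P p;
  window_mean_le : mean_degree n P p <= 5 / 4 * ln n%:R;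
  window_prob : n%:R * p * ln n%:R <= 1;
  window_objects : (2 * l <= P)%N
}.

Lemma pair_used_prob_ge (R : realType) (n P : nat) (p : R) (b := p ^+ 2 * P%:R) :
  0 <= p <= 1 -> b <= 1 -> b * (1 - n%:R * p - b) <= 1 - (1 - pair_prob n p) ^+ P.
Proof.
move=> p01 b1; have /andP[p0 p1] := p01; pose c := (1 - p) ^+ (n - 2).
have c0 : 0 <= c by rewrite exprn_ge0// subr_ge0.
have /andP[c_ge c1] : 1 - n%:R * p <= c <= 1 := expr_onesub_itv n 2 p01.
have b0 : 0 <= b by rewrite mulr_ge0 ?exprn_ge0.
have /andP[_ /(expr_onesub_le_expR P)] := pair_prob_itv n p01.
rewrite (_ : P%:R * pair_prob n p = b * c); last by rewrite /b /c /pair_prob; ring.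
have := onesub_expRN_ge (mulr_ge0 b0 c0).
have : b * (1 - n%:R * p - b) <= b * c - (b * c) ^+ 2.
  rewrite expr2 -mulrA -mulrBr ler_wpM2l// lerB// mulrCA.
  by rewrite ler_piMr// mulr_ile1.
lra.
Qed.

Section CriticalWindow.
Variables (R : realType) (n P l : nat) (p : R).
Hypothesis p01 : 0 <= p <= 1.
Hypothesis window : critical_window n P l p.

Let N : R := n%:R.
Let L : R := ln N.
Let b : R := p ^+ 2 * P%:R.
Let d : R := mean_degree n P p.
Let scale : R := low_degree_scale n l d.

Let dE : d = N * b. Proof. by []. Qed.
(* [lra] and [nra] do not see section-local facts: the proofs below restate those
   that they need. *)
Let p_ge0 : 0 <= p. Proof. by case/andP: p01. Qed.
Let b_ge0 : 0 <= b. Proof. by rewrite mulr_ge0 ?exprn_ge0. Qed.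
Let L_ge24 : 24 <= L. Proof. exact: window_ln window. Qed.
Let d_ge : 3 / 4 * L <= d. Proof. exact: window_mean_ge window. Qed.
Let d_le : d <= 5 / 4 * L. Proof. exact: window_mean_le window. Qed.

Let N_gt0 : 0 < N.
Proof. by rewrite ltNge; apply: contraTN L_ge24 => /ln0 N0; rewrite -ltNge /L N0 ltr0n. Qed.

Let expR_L : expR L = N. Proof. exact: lnK. Qed.

Let sqrL_le : 4 * L ^+ 2 <= N. Proof. by rewrite -expR_L sqr_le_expR. Qed.

Let scale_ge0 : 0 <= scale.
Proof.
by rewrite !mulr_ge0 ?exprn_ge0 ?expR_ge0//; apply: le_trans L_ge24.
Qed.

Let Np_ge0 : 0 <= N * p. Proof. by rewrite mulr_ge0// ltW. Qed.

Let Np_le : N * p <= L^-1.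
Proof.
have L24 := L_ge24.
by rewrite -[leRHS]mul1r ler_pdivlMr; [exact: window_prob window|lra].
Qed.

Let Linv_le : L^-1 <= 1 / 24.
Proof. by have L24 := L_ge24; rewrite div1r lef_pV2 ?posrE//; lra. Qed.

Let q : R := (1 - pair_prob n p) ^+ P.

Let q_itv : 0 <= q <= 1.
Proof.
have /andP[beta0 beta1] := pair_prob_itv n p01.
by rewrite exprn_ge0 ?exprn_ile1 ?subr_ge0// lerBlDr lerDl.
Qed.

Lemma cut_exponent_le (t : nat) : (t <= n)%N ->
  (n - t)%:R * b - 3 <= (n - t)%:R * ((1 - L^-1) * (1 - q)).
Proof.
have [L24 d_L N0 LN Linv1] := And5 L_ge24 d_le N_gt0 sqrL_le Linv_le.
have [Np0 Np_L b0] := And3 Np_ge0 Np_le b_ge0.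
have d0 : 0 <= d by rewrite mulr_ge0// ltW.
move=> tn; have Linv0 : 0 < L^-1 by rewrite invr_gt0; lra.
have db_le : d * b <= 1 / 2.
  rewrite -(ler_pM2l N_gt0) mulrCA -dE; apply: (@le_trans _ _ ((5 / 4 * L) * (5 / 4 * L))).
    by rewrite ler_pM//; lra.
  by nra.
have b_le1 : b <= 1 by rewrite -(ler_pM2l N_gt0) mulr1 -dE; nra.
have error_le : d * (L^-1 + N * p + b) <= 3.
  have dL : d * L^-1 <= 5 / 4 by rewrite ler_pdivrMr; lra.
  have dNp : d * (N * p) <= d * L^-1 by rewrite ler_wpM2l//; lra.
  lra.
have used_ge := pair_used_prob_ge n p01 b_le1; rewrite -/N -/q -/b in used_ge.
have per_node : b - b * (L^-1 + N * p + b) <= (1 - L^-1) * (1 - q).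
  apply: le_trans (ler_wpM2l _ used_ge); last by lra.
  have : 0 <= b * (L^-1 * (N * p + b)) by rewrite mulr_ge0// mulr_ge0 ?addr_ge0// ltW.
  lra.
apply: le_trans (ler_wpM2l _ per_node); last exact: ler0n.
rewrite mulrBr lerB//; apply: le_trans error_le; rewrite dE -mulrA ler_wpM2r//.
  by rewrite mulr_ge0// !addr_ge0// ltW.
by rewrite ler_nat leq_subr.
Qed.

Lemma cut_base_le (t : nat) : (t <= n)%N ->
  L^-1 ^- l * (L^-1 + (1 - L^-1) * q) ^+ (n - t) <=
  expR 3 * scale / N * expR (t%:R * b).
Proof.
have [L24 N0 Linv1] := And3 L_ge24 N_gt0 Linv_le.
move=> tn; have /andP[q0 q1] := q_itv.
have Linv0 : 0 < L^-1 by rewrite invr_gt0; lra.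
rewrite (_ : L^-1 + _ = 1 - (1 - L^-1) * (1 - q)); last by ring.
rewrite (_ : _ * scale / N * _ = L ^+ l * expR (3 - d + t%:R * b)); last first.
  by rewrite /scale /low_degree_scale !expRD; field; rewrite gt_eqF.
rewrite -exprVn invrK ler_wpM2l ?exprn_ge0//; first by lra.
apply: le_trans (expr_onesub_le_expR _ _) _; first by nra.
have := cut_exponent_le tn; rewrite ler_expR natrB// mulrBl -/N -dE; lra.
Qed.

Lemma expR_cut_le (t : nat) : (0 < t)%N -> (2 * t <= n)%N ->
  expR (t%:R * b) <= expR 1 * t%:R.
Proof.
have [L24 d_L N0] := And3 L_ge24 d_le N_gt0.
move=> t_gt0 tn; have t1 : 1 <= t%:R :> R by rewrite ler1n.
rewrite -[X in _ <= _ * X](@lnK _ t%:R) ?posrE ?ltr0n// -expRD ler_expR.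
have half : t%:R <= N / 2 by rewrite ler_pdivlMr// mulrC -natrM ler_nat.
have ln2 : ln 2 <= 1 :> R by have := @le_ln1Dx R 1; rewrite (_ : 1 + 1 = 2 :> R)//; apply; lra.
have := mulr_1Dln_le t1 half; rewrite ln_div ?posrE// -/L => ln_mono.
rewrite -(ler_pM2l N_gt0) mulrCA -dE.
have : t%:R * d <= t%:R * (5 / 4 * L) by rewrite ler_wpM2l.
have : t%:R * (5 / 4 * L) <= t%:R * (2 * (1 + (L - ln 2))) by rewrite ler_wpM2l//; lra.
lra.
Qed.

Lemma Gb_prob_k_robust_ge :
  1 - 2 * (expR 5 * scale) <= Gb_prob P p (fun adj : rel 'I_n => k_robust adj l.+1).
Proof.
have [L24 N0 Linv1] := And3 L_ge24 N_gt0 Linv_le.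
set y := expR 5 * scale; have y0 : 0 <= y by rewrite mulr_ge0 ?expR_ge0.
have [y_le|y_gt] := leP y (1 / 2); last first.
  have := @Gb_prob_itv R n P p (fun adj => k_robust adj l.+1) p01; lra.
have Linv : 0 < L^-1 <= 1 by rewrite invr_gt0; lra.
have /andP[q0 _] := q_itv.
rewrite lerBlDr -lerBlDl; apply: le_trans (Gb_prob_not_k_robust_le n P p01 l Linv) _.
apply: (@le_trans _ _ (\sum_(t < n.+1 | (0 < t)%N && (2 * t <= n)%N) y ^+ t)); last first.
  apply: (@sumr_exp_pos_le _ y n (fun t => (0 < t)%N && (2 * t <= n)%N)) => [|t /andP[]//].
  by rewrite y0.
apply: ler_sum => t /andP[t_gt0 tn]; have t_le : (t <= n)%N by rewrite -ltnS.
have base_ge0 : 0 <= L^-1 ^- l * (L^-1 + (1 - L^-1) * q) ^+ (n - t).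
  by rewrite mulr_ge0 ?invr_ge0 ?exprn_ge0 ?addr_ge0 ?mulr_ge0//; lra.
apply: le_trans (ler_wpM2r (exprn_ge0 _ base_ge0) (bin_le_expR R n t_gt0)) _.
have edges0 : 0 <= expR 1 * N / t%:R by rewrite !mulr_ge0 ?invr_ge0 ?expR_ge0// ltW.
rewrite -exprMn lerXn2r ?nnegrE ?(mulr_ge0 edges0 base_ge0)//.
apply: le_trans (ler_wpM2l edges0 (cut_base_le t_le)) _.
have per_edge0 : 0 <= expR 3 * scale / N by rewrite divr_ge0 ?(mulr_ge0 (expR_ge0 _) scale_ge0).
apply: le_trans (ler_wpM2l edges0 (ler_wpM2l per_edge0 (expR_cut_le t_gt0 tn))) _.
have exp5 : expR 5 = expR 1 * expR 3 * expR 1 :> R by rewrite -!expRD; congr expR; ring.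
rewrite /y exp5 [leLHS](_ : _ = expR 1 * expR 3 * expR 1 * scale)//.
by field; rewrite !gt_eqF// ltr0n.
Qed.

Let a : R := unshared_prob n p.
Let beta : R := pair_prob n p.
Let gamma : R := paired_prob n p.
Let y : R := N * p ^+ 2.
Let mean_links : R := 'C(P, l)%:R * (gamma ^+ l * a ^+ (P - l)).

Let L_leN : L <= N. Proof. by have [L24 LN] := (L_ge24, sqrL_le); nra. Qed.

Let p_gt0 : 0 < p.
Proof.
have [L24 d_L] := (L_ge24, d_ge); rewrite lt_neqAle p_ge0 andbT.
apply: contraTneq d_ge => p0; rewrite -ltNge dE /b -p0 expr0n mul0r mulr0; lra.
Qed.

Let Ny_le1 : N * y <= 1.
Proof.
have [Np0 Np_L Linv1] := And3 Np_ge0 Np_le Linv_le.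
by rewrite (_ : N * y = (N * p) ^+ 2) ?exprn_ile1//; [lra|rewrite /y; ring].
Qed.

Let y_itv : 0 <= y <= 1 / 24.
Proof.
have [L24 N_L Ny1] := And3 L_ge24 L_leN Ny_le1.
have y0 : 0 <= y by rewrite mulr_ge0 ?exprn_ge0 ?(ltW N_gt0).
by rewrite y0/=; nra.
Qed.

Let a_itv : 1 - y <= a <= 1. Proof. exact: unshared_prob_itv. Qed.

Let beta_ge : p ^+ 2 / 2 <= beta.
Proof.
have [Np_L Linv1] := (Np_le, Linv_le).
have /andP[c_ge _] := expr_onesub_itv n 2 p01; rewrite -/N in c_ge.
by rewrite ler_wpM2l ?exprn_ge0//; lra.
Qed.

Let beta_gt0 : 0 < beta.
Proof. by apply: lt_le_trans beta_ge; rewrite divr_gt0 ?(exprn_gt0 _ p_gt0). Qed.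

Let gamma_ge : y / 4 <= gamma.
Proof.
have [L24 N_L] := (L_ge24, L_leN); rewrite (_ : y / 4 = N / 2 * (p ^+ 2 / 2)).
  by rewrite ler_pM ?divr_ge0 ?exprn_ge0// -/N; lra.
by rewrite /y; field.
Qed.

Let gamma_gt0 : 0 < gamma.
Proof. by have [L24 N_L] := (L_ge24, L_leN); rewrite (mulr_gt0 _ beta_gt0)// -/N; lra. Qed.

Lemma bin_paired_prob_ge : (L / 16) ^+ l / l`!%:R <= 'C(P, l)%:R * gamma ^+ l.
Proof.
have [L24 d_L] := (L_ge24, d_ge); have /andP[y0 _] := y_itv.
apply: le_trans (ler_wpM2r _ (bin_ge_half_exp R (window_objects window))); last first.
  by rewrite exprn_ge0// ltW.
rewrite mulrAC -exprMn ler_wpM2r ?invr_ge0// lerXn2r ?nnegrE//; first by lra.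
  by rewrite mulr_ge0 ?divr_ge0// ltW.
have : P%:R / 2 * (y / 4) <= P%:R / 2 * gamma by rewrite ler_wpM2l ?gamma_ge ?divr_ge0.
rewrite (_ : P%:R / 2 * (y / 4) = d / 8); last by rewrite dE /y /b; field.
lra.
Qed.

Lemma exp_unshared_prob_ge : expR (- (d + 1)) <= a ^+ (P - l).
Proof.
have [L24 d_L N_L Ny1] := And4 L_ge24 d_le L_leN Ny_le1.
have /andP[y0 y1] := y_itv; have /andP[a_ge a_le] := a_itv.
apply: (@le_trans _ _ ((1 - y) ^+ P)); last first.
  apply: (@le_trans _ _ (a ^+ P)); first by rewrite lerXn2r ?nnegrE//; lra.
  by rewrite ler_wiXn2l ?leq_subr//; lra.
apply: (@le_trans _ _ (expR (- (y / (1 - y))) ^+ P)); last first.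
  by rewrite lerXn2r ?nnegrE ?expR_ge0 ?expRN_div_onesub_le//; lra.
rewrite -expRM_natl ler_expR mulrN lerN2 mulrA ler_pdivrMr; last by lra.
rewrite (_ : P%:R * y = d); last by rewrite dE /y /b; ring.
have : d * y <= 5 / 4 * L * y by rewrite ler_wpM2r.
have : 96 * L * y <= N * y by rewrite ler_wpM2r//; have := sqrL_le; nra.
lra.
Qed.

Lemma mean_has_links_ge : scale / (expR 1 * 16 ^+ l * l`!%:R) <= N * mean_links.
Proof.
have fact_gt0 : 0 < l`!%:R :> R by rewrite ltr0n fact_gt0.
rewrite (_ : _ / _ = N * ((L / 16) ^+ l / l`!%:R * expR (- (d + 1)))); last first.
  rewrite /scale /low_degree_scale -/N -/L opprD expRD (expRN 1) expr_div_n.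
  by field; rewrite !gt_eqF ?exprn_gt0 ?expR_gt0.
rewrite ler_wpM2l ?(ltW N_gt0)// /mean_links mulrA.
rewrite ler_pM ?bin_paired_prob_ge ?exp_unshared_prob_ge ?expR_ge0//.
by rewrite divr_ge0 ?exprn_ge0 ?divr_ge0// (le_trans _ L_ge24).
Qed.

Lemma exp_sqr_unshared_prob_le :
  (a ^+ 2 + p ^+ 2) ^+ P <= (a ^+ (P - l)) ^+ 2 * expR (5 / L).
Proof.
have [L24 d_L N_L LN] := And4 L_ge24 d_le L_leN sqrL_le.
have /andP[y0 y1] := y_itv; have /andP[a_ge a_le] := a_itv.
have a0 : 0 <= a by lra.
have sqr_a_ge : 1 / 4 <= a ^+ 2 by nra.
apply: (@le_trans _ _ ((a ^+ 2 * expR (4 * p ^+ 2)) ^+ P)).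
  rewrite lerXn2r ?nnegrE ?addr_ge0 ?mulr_ge0 ?sqr_ge0 ?expR_ge0//.
  apply: (@le_trans _ _ (a ^+ 2 * (1 + 4 * p ^+ 2))); last first.
    by rewrite ler_wpM2l ?sqr_ge0 ?expR_ge1Dx.
  by have := ler_wpM2r (sqr_ge0 p) sqr_a_ge; lra.
rewrite exprMn -expRM_natl ler_pM ?exprn_ge0 ?expR_ge0//.
  rewrite -!exprM ler_wiXn2l//.
  by rewrite mulnC leq_mul2l leq_subr.
rewrite ler_expR (_ : _ * _ = 4 * b); last by rewrite /b; ring.
have N0 := N_gt0; rewrite ler_pdivlMr; last by lra.
rewrite -(ler_pM2l N0) (_ : N * _ = 4 * (d * L)); last by rewrite dE; ring.
have : d * L <= 5 / 4 * L * L by rewrite ler_wpM2r//; lra.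
lra.
Qed.

Lemma expV_near1_le (r : R) : 1 - 2 * y <= r -> (r ^+ (2 * l))^-1 <= expR (8 * l%:R / L).
Proof.
move=> r_ge; have [L24 N_L Ny1] := And3 L_ge24 L_leN Ny_le1.
have /andP[y0 y1] := y_itv.
apply: (@le_trans _ _ (expR (4 * y) ^+ (2 * l))).
  rewrite -exprVn lerXn2r ?nnegrE ?invr_ge0 ?expR_ge0//; first by lra.
  apply: le_trans (expR_ge1Dx _); rewrite -[leLHS]mul1r ler_pdivrMr; last by lra.
  by nra.
rewrite -expRM_natl ler_expR natrM ler_pdivlMr; last by lra.
rewrite (_ : _ * L = 8 * l%:R * (y * L)); last by ring.
by rewrite ler_piMr// mulrC; apply: le_trans Ny1; rewrite ler_wpM2r.
Qed.

Lemma overlap_factor_le : overlap_factor n P l p <= expR (16 * l%:R ^+ 2 / L).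
Proof.
have [L24 N_L d_L N0] := And4 L_ge24 L_leN d_ge N_gt0; have /andP[y0 _] := y_itv.
rewrite (_ : 16 * l%:R ^+ 2 / L = l%:R * (16 * l%:R / L)); last by ring.
have ratio0 : 0 <= link_ratio n p * (l%:R / (P - l).+1%:R).
  by rewrite mulr_ge0 ?link_ratio_ge0 ?divr_ge0.
rewrite expRM_natl lerXn2r ?nnegrE ?expR_ge0 ?addr_ge0//.
apply: le_trans (expR_ge1Dx _); rewrite lerD2l.
have -> : link_ratio n p = ((N - 1) * gamma)^-1.
  by rewrite /link_ratio /gamma /paired_prob -/beta -/N; field; rewrite !gt_eqF//; lra.
rewrite mulrCA mulrC -invfM (_ : 16 * l%:R / L = (L / 16)^-1 * l%:R); last first.
  by field; rewrite gt_eqF//; lra.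
have N1gamma_gt0 : 0 < (N - 1) * gamma by rewrite (mulr_gt0 _ gamma_gt0)//; lra.
rewrite ler_wpM2r// lef_pV2 ?posrE ?(mulr_gt0 N1gamma_gt0) ?ltr0n//; last by lra.
have objects_ge : P%:R / 2 <= (P - l).+1%:R :> R.
  have l_le : l%:R * 2 <= P%:R :> R by rewrite -natrM ler_nat mulnC (window_objects window).
  by rewrite -[leRHS]natr1 natrB; [lra|rewrite (leq_trans _ (window_objects window))// leq_pmull].
apply: (@le_trans _ _ (P%:R / 2 * (N / 2 * (y / 4)))).
  rewrite (_ : P%:R / 2 * _ = N * d / 16); last by rewrite dE /y /b; field.
  have : N * 1 <= N * d by rewrite ler_wpM2l//; lra.
  lra.
rewrite [leRHS]mulrC ler_pM ?mulr_ge0 ?divr_ge0 ?(ltW N_gt0)// ler_pM ?divr_ge0 ?(ltW N_gt0)//.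
lra.
Qed.

Lemma Pr_has_links2_le_mean (i j : 'I_n) : i != j ->
  Pr (@object_sets_pmf R n P p) (fun S => has_links l i S && has_links l j S) <=
  mean_links ^+ 2 * expR ((5 + 8 * l%:R + 16 * l%:R ^+ 2) / L).
Proof.
move=> ij; pose r : R := Pr (subset_pmf p) (fun H => unshared i H && unshared j H).
have [L24 r_le] := (L_ge24, Pr_unshared2_le p01 ij).
have := Pr_unshared2_ge p01 i j; rewrite card_ord -/r -/N -/y => r_ge.
have /andP[y0 y1] := y_itv; have r_gt0 : 0 < r by lra.
apply: le_trans (Pr_has_links2_le P l p01 ij gamma_gt0 r_gt0) _; rewrite -/r.
rewrite /mean_links [in leRHS]mulrA [in leRHS]exprMn -[leRHS]mulrA ler_wpM2l ?sqr_ge0//.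
rewrite 2!mulrDl 2!expRD 2![in leRHS]mulrA.
rewrite ler_pM ?overlap_factor_le//.
- by rewrite divr_ge0 ?exprn_ge0 ?ltW.
- exact: overlap_factor_ge0.
rewrite ler_pM ?expV_near1_le ?invr_ge0 ?exprn_ge0 ?(ltW r_gt0)//.
apply: (le_trans _ exp_sqr_unshared_prob_le).
rewrite lerXn2r ?nnegrE ?addr_ge0 ?sqr_ge0 ?(ltW r_gt0)//.
by rewrite card_ord in r_le.
Qed.

Lemma Gb_prob_k_robust_le :
  Gb_prob P p (fun adj : rel 'I_n => k_robust adj l.+1) <=
  expR 1 * 16 ^+ l * l`!%:R / scale +
  (expR ((5 + 8 * l%:R + 16 * l%:R ^+ 2) / L) - 1).
Proof.
have [L24 N_L] := (L_ge24, L_leN).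
have scale_gt0 : 0 < scale.
  by rewrite /scale /low_degree_scale !mulr_gt0 ?exprn_gt0 ?expR_gt0// (lt_le_trans _ L24).
have coef_gt0 : 0 < expR 1 * 16 ^+ l * l`!%:R :> R.
  by rewrite !mulr_gt0 ?exprn_gt0 ?expR_gt0// ltr0n fact_gt0.
have mean_gt0 : 0 < N * mean_links.
  by apply: lt_le_trans mean_has_links_ge; rewrite divr_gt0.
have n1 : (1 < n)%N by rewrite -(ltr_nat R) -/N; lra.
apply: le_trans (Gb_prob_k_robust_le_none P l p01 n1) _.
have := @Pr_none_le R _ _ (object_sets_pmf_is_pmf n P p01) 'I_n (has_links l) mean_links.
rewrite card_ord => /(_ _ mean_gt0 (expR_ge0 _) (Pr_has_links P l p01) Pr_has_links2_le_mean).
move=> /le_trans; apply; rewrite lerD2r -invf_div lef_pV2 ?posrE ?divr_gt0//.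
exact: mean_has_links_ge.
Qed.

End CriticalWindow.

(** * The critical window *)

Local Open Scope classical_set_scope.

Lemma cvg_ln_natr (R : realType) : ln (n%:R : R) @[n --> \oo] --> +oo.
Proof.
apply/cvgryPge => A; near=> n; have An : expR A <= n%:R by near: n; exact: nbhs_infty_ger.
by rewrite -[A]expRK ler_ln ?posrE ?expR_gt0//; apply: lt_le_trans An; exact: expR_gt0.
Unshelve. all: by end_near. Qed.

Section Asymptotics.
Variables (R : realType) (l : nat) (P : nat -> nat) (p alpha : nat -> R).
Hypothesis p01 : forall n, 0 <= p n <= 1.
Hypothesis mean_degreeE : forall n, (1 < n)%N ->
  mean_degree n (P n) (p n) = ln n%:R + l%:R * ln (ln n%:R) + alpha n.
Hypothesis objects_Omega : (fun n : nat => (P n)%:R : R) \is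
  'Omega_\oo (fun n : nat => n%:R * ln n%:R ^+ 5 : R).
Hypothesis alpha_o : (fun n : nat => `|alpha n|) =o_\oo (fun n : nat => ln n%:R : R).

Let ln_ge (A : R) : \forall n \near \oo, A <= ln (n%:R : R).
Proof. by have /cvgryPge := @cvg_ln_natr R; exact. Qed.

Lemma objects_ge_near (A : R) :
  \forall n \near \oo, A * (n%:R * ln n%:R ^+ 4) <= (P n)%:R.
Proof.
have := objects_Omega; rewrite qualifE => /asboolP[c c0 P_ge]; near=> n.
have L1 : 1 <= ln n%:R :> R by near: n; exact: ln_ge.
have L_ge : A / c <= ln n%:R :> R by near: n; exact: ln_ge.
have : c * `|n%:R * ln n%:R ^+ 5 : R| <= `|(P n)%:R : R| by near: n; exact: P_ge.
rewrite !ger0_norm ?mulr_ge0 ?exprn_ge0 ?(le_trans ler01 L1)//; apply: le_trans.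
rewrite (_ : c * _ = c * ln n%:R * (n%:R * ln n%:R ^+ 4)); last by ring.
rewrite ler_wpM2r ?mulr_ge0 ?exprn_ge0 ?(le_trans ler01 L1)//.
by rewrite mulrC -ler_pdivrMr.
Unshelve. all: by end_near. Qed.

Lemma mean_degree_near : \forall n \near \oo,
  3 / 4 * ln n%:R <= mean_degree n (P n) (p n) <= 5 / 4 * ln n%:R.
Proof.
have alpha_near : \forall n \near \oo, `| `|alpha n| | <= 8^-1 * `|ln n%:R : R|.
  by move/eqoP: alpha_o; apply; rewrite invr_gt0.
near=> n; have n1 : (1 < n)%N by near: n; exact: nbhs_infty_gt.
have L0 : 0 <= ln n%:R :> R by near: n; exact: ln_ge.
have /mulr_ln_le_div8/andP[lnln0 lnln_le] : expR (16 * l%:R) <= ln n%:R :> R.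
  by near: n; exact: ln_ge.
have : `| `|alpha n| | <= 8^-1 * `|ln n%:R : R| by near: n; exact: alpha_near.
rewrite normr_id (ger0_norm L0) ler_norml mean_degreeE// => /andP[alpha_ge alpha_le].
by apply/andP; split; lra.
Unshelve. all: by end_near. Qed.

Lemma critical_window_near : \forall n \near \oo, critical_window n (P n) l (p n).
Proof.
near=> n; have L24 : 24 <= ln n%:R :> R by near: n; exact: ln_ge.
have /andP[d_ge d_le] : 3 / 4 * ln n%:R <= mean_degree n (P n) (p n) <= 5 / 4 * ln n%:R.
  by near: n; exact: mean_degree_near.
have [p0 _] := andP (p01 n).
have N1 : 1 <= n%:R :> R by near: n; exact: nbhs_infty_ger.
have P_ge : 2 * (n%:R * ln n%:R ^+ 4) <= (P n)%:R :> R by near: n; exact: objects_ge_near.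
have Pl_ge : (2 * l)%:R * (n%:R * ln n%:R ^+ 4) <= (P n)%:R :> R.
  by near: n; exact: objects_ge_near.
have NL1 : 1 <= n%:R * ln n%:R ^+ 4 :> R by rewrite mulr_ege1// exprn_ege1//; lra.
split=> //; last by rewrite -(ler_nat R); apply: le_trans Pl_ge; rewrite ler_peMr.
set L := ln n%:R in d_ge d_le L24 P_ge NL1 *.
have P_gt0 : 0 < (P n)%:R :> R by lra.
rewrite -(@ler_sqr _ _ 1) ?nnegrE ?mulr_ge0//; last by lra.
rewrite expr1n -(ler_pM2r P_gt0) mul1r; apply: le_trans P_ge.
rewrite (_ : _ * (P n)%:R = n%:R * (mean_degree n (P n) (p n) * L ^+ 2)); last first.
  by rewrite /mean_degree; ring.
rewrite [leRHS]mulrCA ler_wpM2l// (_ : 2 * L ^+ 4 = 2 * L ^+ 2 * L ^+ 2); last by ring.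
by rewrite ler_wpM2r ?sqr_ge0//; nra.
Unshelve. all: by end_near. Qed.

Lemma low_degree_scale_near : \forall n \near \oo,
  low_degree_scale n l (mean_degree n (P n) (p n)) = expR (- alpha n).
Proof.
near=> n; have n1 : (1 < n)%N by near: n; exact: nbhs_infty_gt.
have L1 : 1 <= ln n%:R :> R by near: n; exact: ln_ge.
have N0 : 0 < n%:R :> R by rewrite ltr0n ltnW.
rewrite /low_degree_scale mean_degreeE// !opprD !expRD -mulrN expRM_natl !expRN.
rewrite !lnK ?posrE//; last by lra.
by rewrite exprVn; field; rewrite !gt_eqF ?exprn_gt0 ?expR_gt0//; lra.
Unshelve. all: by end_near. Qed.

Lemma Gb_prob_k_robust_cvg0 : alpha n @[n --> \oo] --> -oo ->
  Gb_prob (P n) (p n) (fun adj : rel 'I_n => k_robust adj l.+1) @[n --> \oo] --> (0 : R).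
Proof.
move=> alphaNy; pose D : R := expR 1 * 16 ^+ l * l`!%:R.
pose C : R := 5 + 8 * l%:R + 16 * l%:R ^+ 2.
apply: (@squeeze_cvgr _ _ _ _ (fun=> 0)
  (fun n => D * expR (- - alpha n) + (expR (C / ln n%:R) - 1))).
- near=> n; have /andP[-> _] := @Gb_prob_itv R n (P n) (p n)
    (fun adj => k_robust adj l.+1) (p01 n).
  have window : critical_window n (P n) l (p n) by near: n; exact: critical_window_near.
  have scaleE : low_degree_scale n l (mean_degree n (P n) (p n)) = expR (- alpha n).
    by near: n; exact: low_degree_scale_near.
  by have := Gb_prob_k_robust_le (p01 n) window; rewrite scaleE -expRN.
- exact: cvg_cst.
have exp_alpha : expR (- - alpha n) @[n --> \oo] --> (0 : R).
  have alphaN : - alpha n @[n --> \oo] --> +oo by apply/cvgNry.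
  exact: cvg_comp _ _ alphaN (@cvgr_expR R).
have inv_ln : C / ln n%:R @[n --> \oo] --> (0 : R).
  rewrite -[X in _ --> X](mulr0 C); apply: cvgM; first exact: cvg_cst.
  apply/gtr0_cvgV0; last exact: cvg_ln_natr.
  by have := ln_ge 1; apply: filterS => n; apply: lt_le_trans.
have <- : D * 0 + (expR 0 - 1) = 0 :> R by rewrite mulr0 expR0 subrr addr0.
apply: cvgD; first by apply: cvgM exp_alpha; exact: cvg_cst.
by apply: cvgB; [exact: (cvg_comp _ _ inv_ln (@continuous_expR R 0))|exact: cvg_cst].
Unshelve. all: by end_near. Qed.

Lemma Gb_prob_k_robust_cvg1 : alpha n @[n --> \oo] --> +oo ->
  Gb_prob (P n) (p n) (fun adj : rel 'I_n => k_robust adj l.+1) @[n --> \oo] --> (1 : R).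
Proof.
move=> alphay; apply: (@squeeze_cvgr _ _ _ _
  (fun n => 1 - 2 * (expR 5 * expR (- alpha n))) (fun=> 1)); last exact: cvg_cst.
  near=> n; have /andP[_ ->] := @Gb_prob_itv R n (P n) (p n)
    (fun adj => k_robust adj l.+1) (p01 n).
  have window : critical_window n (P n) l (p n) by near: n; exact: critical_window_near.
  have <- : low_degree_scale n l (mean_degree n (P n) (p n)) = expR (- alpha n).
    by near: n; exact: low_degree_scale_near.
  by rewrite (Gb_prob_k_robust_ge (p01 n) window).
rewrite -[X in _ --> X]subr0 -(mulr0 2) -(mulr0 (expR 5)).
apply: cvgB; first exact: cvg_cst.
by do 2 (apply: cvgM; first exact: cvg_cst); exact: (cvg_comp _ _ alphay (@cvgr_expR R)).
Unshelve. all: by end_near. Qed.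

End Asymptotics.

Theorem theorem5 (R : realType) (k : nat) (P : nat -> nat)
    (p alpha : nat -> R)
    (hk : (0 < k)%N)
    (hp : forall n, 0 <= p n <= 1)
    (halpha : forall n, (2 <= n)%N ->
       p n ^+ 2 * (P n)%:R =
       (ln n%:R + (k%:R - 1) * ln (ln n%:R) + alpha n) / n%:R)
    (hP : (fun n : nat => (P n)%:R : R) \is
       'Omega_\oo (fun n : nat => n%:R * ln n%:R ^+ 5 : R))
    (halpha_o : (fun n : nat => `|alpha n|) =o_\oo (fun n : nat => ln n%:R : R)) :
  (alpha n @[n --> \oo] --> -oo ->
     Gb_prob (P n) (p n) (fun adj : rel 'I_n => k_robust adj k)
       @[n --> \oo] --> (0 : R)) /\
  (alpha n @[n --> \oo] --> +oo ->
     Gb_prob (P n) (p n) (fun adj : rel 'I_n => k_robust adj k)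
       @[n --> \oo] --> (1 : R)).
Proof.
case: k hk halpha => // l _ halpha.
have mean_degreeE n : (1 < n)%N ->
    mean_degree n (P n) (p n) = ln n%:R + l%:R * ln (ln n%:R) + alpha n.
  move=> n1; rewrite /mean_degree halpha// -natr1 addrK mulrC divfK//.
  by rewrite pnatr_eq0 -lt0n ltnW.
split; first exact: Gb_prob_k_robust_cvg0 hp mean_degreeE hP halpha_o.
exact: Gb_prob_k_robust_cvg1 hp mean_degreeE hP halpha_o.
Qed.
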